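(* Let $X$ be a countable (possibly finite) set with $\mathcal F=2^X$ the collection of all subsets and $P$ a probability measure on $\mathcal F$. Let $\mathcal A$ be the $\sigma$-algebra generated by a (countable) partition $\{A_i\}_i$ of $X$ whose members are the atoms of $\mathcal A$, with $P(A_i)>0$ for every $i$, and let $v_{\mathcal A}$ be the capacity induced by $\mathcal A$. The following are equivalent: 1. $\mathcal A$ is generated by atoms consisting of finitely many elements of $X$, i.e. every $A_i$ is a finite set; 2. $\lim_n\int_X f_n\,dv_{\mathcal A}=\int_X f\,dv_{\mathcal A}$ for every increasing sequence $\{f_n\}_n\subset\mathcal M$ converging pointwise to a function $f\in\mathcal M$; 3. $\lim_n\int_X f_n\,dv_{\mathcal A}=\int_X f\,dv_{\mathcal A}$ for every increasing sequence $\{f_n\}_n\subset\mathcal M$ converging strongly $v_{\mathcal A}$-a.e. to a function $f\in\mathcal M$; 4. $v_{\mathcal A}$ is continuous from below.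
   Context: $\mathcal M$ is the collection of all nonnegative functions on $X$. The capacity induced by $\mathcal A$ is $v_{\mathcal A}(F)=\max\{P(A): A\in\mathcal A, A\subseteq F\}$, $F\in\mathcal F$ (the maximum is attained). $\int_X f\,dv_{\mathcal A}$ is the Choquet integral $\int_0^\infty v_{\mathcal A}(\{x: f(x)\ge t\})\,dt\in[0,\infty]$; since $v_{\mathcal A}$ is convex (i.e. $v_{\mathcal A}(F)+v_{\mathcal A}(E)\le v_{\mathcal A}(F\cup E)+v_{\mathcal A}(F\cap E)$), it coincides with the concave integral $\sup\{\sum_{i=1}^N\lambda_i v_{\mathcal A}(F_i):\sum_{i=1}^N\lambda_i\mathbf 1_{F_i}\le f, F_i\in\mathcal F,\lambda_i\ge0, N\in\mathbb N\}$. A sequence $\{f_n\}_n$ is increasing if $f_n\le f_{n+1}$ pointwise for all $n$. $\{f_n\}_n$ converges to $f$ strongly $v_{\mathcal A}$-a.e. if $v_{\mathcal A}(\{x\in F: f_n(x)\to f(x)\})=v_{\mathcal A}(F)$ for all $F\in\mathcal F$. $v_{\mathcal A}$ is continuous from below if $\lim_n v_{\mathcal A}(F_n)=v_{\mathcal A}(\bigcup_n F_n)$ for every increasing sequence $F_1\subseteq F_2\subseteq\cdots$ in $\mathcal F$. *)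

(* Defs.v *)
From HB Require Import structures.
From mathcomp Require Import all_boot all_order all_algebra.
From mathcomp Require Import all_classical all_reals all_analysis.
Set Implicit Arguments.
Unset Strict Implicit.
Unset Printing Implicit Defensive.
Import Order.TTheory GRing.Theory Num.Theory.
Import numFieldNormedType.Exports.
Local Open Scope classical_set_scope.
Local Open Scope ring_scope.
Local Open Scope ereal_scope.

(* Set functions are total on [set X]: they are used on a countable X
   endowed with the sigma-algebra of all its subsets. *)

(* The supremum is a maximum when [X] is countable and [G] is a
   sigma-algebra of measurable sets, see [capacity_max] below. *)
Definition capacity (d : measure_display) (X : measurableType d) (R : realType)
    (P : probability X R) (G : set (set X)) (F : set X) : \bar R :=
  ereal_sup [set P A | A in [set A | G A /\ A `<=` F]].

Definition choquet_integral (X : Type) (R : realType)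
    (v : set X -> \bar R) (f : X -> R) : \bar R :=
  \int[@lebesgue_measure R]_(t in `[0%R, +oo[) v [set x | (t <= f x)%R].

Definition cvg_strongly_ae (X : Type) (R : realType) (v : set X -> \bar R)
    (f_ : nat -> X -> R) (f : X -> R) : Prop :=
  forall F : set X, v [set x | F x /\ f_ n x @[n --> \oo] --> f x] = v F.

Definition continuous_from_below (X : Type) (R : realType)
    (v : set X -> \bar R) : Prop :=
  forall F_ : nat -> set X, (forall n, F_ n `<=` F_ n.+1) ->
    v (F_ n) @[n --> \oo] --> v (\bigcup_n F_ n).

Lemma capacity_max (d : measure_display) (X : measurableType d) (R : realType)
    (P : probability X R) (G : set (set X)) (F : set X) :
  countable [set: X] -> sigma_algebra [set: X] G -> G `<=` measurable ->
  exists A, [/\ G A, A `<=` F & capacity P G F = P A].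
Proof.
move=> /countable_injP[e einj] [G0 GC GU] Gm.
have [B BE] : {B : X -> set X & forall x, [/\ G (B x), B x `<=` F &
    (exists A, [/\ G A, A `<=` F & A x]) -> B x x]}.
  apply: (choice (P := fun x B => [/\ G B, B `<=` F &
    (exists A, [/\ G A, A `<=` F & A x]) -> B x])) => x.
  have [[A [GA AF Ax]]|nA] := pselect (exists A, [/\ G A, A `<=` F & A x]).
    by exists A.
  by exists set0; split.
have [C CE] : {C : nat -> set X & forall n,
    [/\ G (C n), C n `<=` F & forall x, e x = n -> B x `<=` C n]}.
  apply: (choice (P := fun n C => [/\ G C, C `<=` F &
    forall x, e x = n -> B x `<=` C])) => n.
  have [[x ex]|nx] := pselect (exists x, e x = n).
    exists (B x); have [? ? _] := BE x; split=> // y ey.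
    by rewrite (einj y x) ?inE// ey ex.
  by exists set0; split=> // x ex; case: nx; exists x.
have GUC : G (\bigcup_n C n) by apply: GU => n; have [] := CE n.
have UCF : \bigcup_n C n `<=` F.
  by move=> x [n _ Cx]; have [_ CF _] := CE n; exact: CF.
exists (\bigcup_n C n); split=> //.
apply/eqP; rewrite eq_le; apply/andP; split.
  apply: ge_ereal_sup => _ [A [GA AF] <-].
  apply: le_measure; rewrite ?inE; [exact: Gm|exact: Gm|].
  move=> x Ax; exists (e x) => //.
  have [_ _ BC] := CE (e x); apply: (BC x) => //.
  by have [_ _] := BE x; apply; exists A.
by apply: ereal_sup_ubound; exists (\bigcup_n C n).
Qed.

(* Main.v *)
Require Import Defs.
From HB Require Import structures.
From mathcomp Require Import all_boot all_order all_algebra.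
From mathcomp Require Import all_classical all_reals all_analysis.
From mathcomp Require Import measurable_realfun.
Set Implicit Arguments.
Unset Strict Implicit.
Unset Printing Implicit Defensive.
Import Order.TTheory GRing.Theory Num.Theory.
Import numFieldNormedType.Exports.
Local Open Scope classical_set_scope.
Local Open Scope ring_scope.

(** The atoms of the sigma-algebra are the [A i], so its largest member
    inside a set [F] is the union of the atoms inside [F], called the atomic
    core of [F] below, and [v F] is the probability of this core
    ([capacityE]).  Everything then depends on how cores behave under
    increasing unions.

    If all atoms are finite, an atom inside an increasing union lies inside one
    of its terms, so cores commute with increasing unions and [v] inherits
    continuity from below from [P]
    ([finite_atoms_continuous_from_below]).  Conversely, exhaust an infinite
    atom [A i] by finite subsets of it: they contain no atom, hence have
    capacity 0, while [v (A i) = P (A i) > 0] ([continuous_from_below_finite_atoms]).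

    Continuity from below gives the pointwise monotone convergence theorem by
    monotone convergence for Lebesgue measure, applied to the functions
    [t |-> v [set x | t <= f_ n x]] ([choquet_integral_cvg]).  The sets
    [[set x | t <= f_ n x]] increase to [[set x | t <= f x]] except perhaps
    when [t] is a value of [f]: if [f_ n x < f x] for all [n], the point [x]
    is missed at [t = f x].  As [X] is countable, so is [range f], and these
    exceptional [t] form a null set.

    Strong almost-everywhere convergence is here the same as pointwise
    convergence: testing it on the full set yields a set of convergence of full
    capacity, and such a set omits no point because every atom has positive
    probability ([capacity_full]).  Finally, the Choquet integral of an
    indicator is the capacity of the set ([choquet_integral_indic]), so the
    convergence theorem for indicators is continuity from below. *)

(** * Preliminaries *)

Lemma ge0_integral_eq_off_countable (R : realType) (D N : set R)
    (g h : R -> \bar R) :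
  measurable D -> countable N ->
  measurable_fun D g -> measurable_fun D h ->
  (forall t, D t -> 0 <= g t)%E -> (forall t, D t -> 0 <= h t)%E ->
  (forall t, D t -> ~ N t -> g t = h t) ->
  (\int[@lebesgue_measure R]_(t in D) g t =
   \int[@lebesgue_measure R]_(t in D) h t)%E.
Proof.
move=> mD cN mg mh g0 h0 gh; apply: ge0_ae_eq_integral => //.
exists N; split.
- exact: countable_measurable.
- exact: countable_lebesgue_measure0.
- move=> t /= ngh; apply: contrapT => nN.
  by apply: ngh => Dt; exact: gh.
Qed.

(** Each point of [B] enters the sequence at some index; as [B] is finite, the
    maximum of these indices serves all of [B]. *)
Lemma finite_sub_bigcup (X : Type) (B : set X) (F_ : nat -> set X) :
  finite_set B -> nondecreasing_seq F_ -> B `<=` \bigcup_n F_ n ->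
  exists n, B `<=` F_ n.
Proof.
move=> Bfin F_nd BF.
have [N NE] : {N : X -> nat & forall x, B x -> F_ (N x) x}.
  apply: (choice (P := fun x n => B x -> F_ n x)) => x.
  have [Bx|nBx] := pselect (B x); last by exists 0%N.
  by have [n _ Fx] := BF x Bx; exists n.
have NBfin := finite_image N Bfin.
exists (\max_(n <- finmap.enum_fset (fset_set (N @` B))) n)%N => x Bx.
have le_N : (N x <= \max_(n <- finmap.enum_fset (fset_set (N @` B))) n)%N.
  by apply: leq_bigmax_seq => //; rewrite in_fset_set// inE; exists x.
by have /subsetPset := F_nd _ _ le_N; apply; exact: NE.
Qed.

(** * Choquet integral with respect to a monotone set function *)

Section monotone_set_functions.
Variables (R : realType) (X : Type) (v : set X -> \bar R).
Hypothesis v_ge0 : forall F, (0 <= v F)%E.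
Hypothesis v_le1 : forall F, (v F <= 1)%E.
Hypothesis v_mono : forall F G, F `<=` G -> (v F <= v G)%E.

(** A monotone real function is Borel; the bound on [v] makes its values real.
    This covers both superlevel sets and their unions along a sequence. *)
Lemma measurable_antitone_family (D : set R) (S : R -> set X) :
  measurable D -> (forall s t : R, s <= t -> S t `<=` S s) ->
  measurable_fun D (fun t => v (S t)).
Proof.
move=> mD S_anti.
have vfin F : v F \is a fin_num.
  by rewrite ge0_fin_numE// (le_lt_trans (v_le1 F))// ltry.
rewrite (_ : (fun t => v (S t)) = EFin \o (fun t => fine (v (S t)))).
  apply/measurable_EFinP; apply: nonincreasing_measurable => // s t st.
  by apply: fine_le => //; apply/v_mono/S_anti.
by apply/funext => t /=; rewrite fineK.
Qed.

Lemma measurable_superlevel (f : X -> R) (D : set R) :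
  measurable D -> measurable_fun D (fun t => v [set x | t <= f x]).
Proof.
move=> mD.
apply: (@measurable_antitone_family D (fun t => [set x | t <= f x])) => //.
by move=> s t st x /=; exact: le_trans.
Qed.

(** By continuity from below the integrands converge to [v (S t)], where [S t]
    is the union of the superlevel sets of the [f_ n].  It lies between
    [[set x | t < f x]] and [[set x | t <= f x]], and these two sets coincide
    for [t] outside the countable set [range f]. *)
Lemma choquet_integral_cvg (f_ : nat -> X -> R) (f : X -> R) :
  countable [set: X] -> continuous_from_below v ->
  (forall n x, f_ n x <= f_ n.+1 x) ->
  (forall x, f_ n x @[n --> \oo] --> f x) ->
  choquet_integral v (f_ n) @[n --> \oo] --> choquet_integral v f.
Proof.
move=> cX vcfb f_incr f_cvg; rewrite /choquet_integral.
have f_nd x : nondecreasing_seq (f_ ^~ x).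
  by apply/nondecreasing_seqP => n; exact: f_incr.
have f_le n x : f_ n x <= f x.
  have <- : limn (f_ ^~ x) = f x by apply: cvg_lim => //; exact: f_cvg.
  apply: nondecreasing_cvgn_le => //.
  by apply/cvg_ex; exists (f x); exact: f_cvg.
pose S t := \bigcup_n [set x | t <= f_ n x].
have S_lim t : limn (fun n => v [set x | t <= f_ n x]) = v (S t).
  apply: cvg_lim => //; apply: vcfb => n x /= tf.
  exact: le_trans tf (f_incr n x).
have -> : (\int[@lebesgue_measure R]_(t in `[0%R, +oo[)
      v [set x | (t <= f x)%R] =
    \int[@lebesgue_measure R]_(t in `[0%R, +oo[) v (S t))%E.
  apply: (@ge0_integral_eq_off_countable _ _ (range f)) => //.
  - exact: card_le_trans (card_image_le f setT) cX.
  - exact: measurable_superlevel.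
  - apply: measurable_antitone_family => // s t st x [n _ /= tf].
    by exists n => //=; exact: le_trans st tf.
  - move=> t _ tf; congr v; apply/seteqP; split => x /=.
      rewrite le_eqVlt => /predU1P[tE|t_lt]; first by case: tf; exists x.
      have /cvgr_ge /(_ _ t_lt) [n _ fn] := f_cvg x.
      by exists n => //=; apply: fn => /=.
    by move=> [n _ /= tfn]; exact: le_trans tfn (f_le n x).
under eq_integral do rewrite -S_lim.
apply: cvg_monotone_convergence => //.
- by move=> n; exact: measurable_superlevel.
- by move=> t _ m n mn; apply: v_mono => x /= /le_trans; apply; exact: f_nd.
Qed.

(** The superlevel set of [\1_F] at [t] is [F] for [0 < t <= 1] and empty for
    [1 < t]. *)
Lemma choquet_integral_indic (F : set X) :
  v set0 = 0%E -> choquet_integral v (\1_F : X -> R) = v F.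
Proof.
move=> v0; rewrite /choquet_integral.
have -> : (\int[@lebesgue_measure R]_(t in `[0%R, +oo[)
      v [set x | (t <= (\1_F : X -> R) x)%R] =
    \int[@lebesgue_measure R]_(t in `[0%R, +oo[)
      (v F * (\1_(`[0%R, 1%R] : set R) t)%:E))%E.
  (* At [t = 0] the superlevel set is all of [X]. *)
  apply: (@ge0_integral_eq_off_countable _ _ [set 0]) => //.
  - exact: measurable_superlevel.
  - apply: emeasurable_funM => //; apply/measurable_EFinP.
    exact: measurable_indic.
  - by move=> t _; rewrite mule_ge0// lee_fin.
  - move=> t /=; rewrite in_itv/= andbT => t0 /eqP tN0.
    have {t0 tN0} t0 : 0 < t by rewrite lt_neqAle eq_sym tN0.
    rewrite indicE mem_setE in_itv/= (ltW t0)/=.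
    have [t1|t1] := leP t 1; rewrite ?mule1 ?mule0.
      congr v; apply/seteqP; split => x /=; rewrite indicE.
        by case: (boolP (x \in F)) => [/set_mem//|_]; rewrite leNgt t0.
      by move=> /mem_set ->.
    rewrite -v0; congr v; apply/seteqP; split => x //=; rewrite indicE.
    by case: (x \in F); rewrite leNgt ?t1 ?t0.
rewrite ge0_integralZl//; last first.
  by apply/measurable_EFinP; exact: measurable_indic.
rewrite integral_indic// setIidl; last first.
  by move=> t /=; rewrite !in_itv/= andbT => /andP[].
have lambda01 : @lebesgue_measure R `[0%R, 1%R]%classic = 1%E.
  by rewrite lebesgue_measure_itv/= lte_fin ltr01 sube0.
by rewrite [X in (_ * X)%E]lambda01 mule1.
Qed.

End monotone_set_functions.

(** * Capacity induced by a countable partition *)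

Section capacity_of_a_partition.
Variables (R : realType) (d : measure_display) (X : measurableType d).
Hypothesis X_discrete : forall F : set X, measurable F.
Variables (P : probability X R) (I : Type) (A : I -> set X).
Hypothesis I_countable : countable [set: I].
Hypothesis A_partition : partition [set: I] A [set: X].

Local Notation v := (capacity P <<s range A >>).

Definition atom_core (F : set X) := \bigcup_(i in [set i | A i `<=` F]) A i.

Lemma atom_core_sub F : atom_core F `<=` F.
Proof. by move=> x [i /= AF Ax]; exact: AF. Qed.

Lemma atom_core_sigma F : <<s range A >> (atom_core F).
Proof.
rewrite /atom_core bigcup_mkcond.
apply: (@countable_bigcupT_measurable _ (g_sigma_algebraType (range A))) => //.
move=> i; case: ifP => _; last exact: measurable0.
by apply: sub_sigma_algebra; exists i.
Qed.

Lemma atom_cover x : exists i, A i x.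
Proof.
have [AX _ _] := A_partition; have : [set: X] x by [].
by rewrite -AX => -[i _ Ax]; exists i.
Qed.

Lemma atom_inj i j x : A i x -> A j x -> i = j.
Proof.
by have [_ A_triv _] := A_partition => Ai Aj; apply: A_triv => //; exists x.
Qed.

(** Unions of atoms form a sigma-algebra containing the atoms, so the generated
    sigma-algebra consists only of such unions. *)
Lemma atom_sub_sigma B i x : <<s range A >> B -> A i x -> B x -> A i `<=` B.
Proof.
move=> GB; move: B GB i x.
apply: smallest_sub; last first.
  by move=> _ [j _ <-] i x Ai Aj; rewrite (atom_inj Ai Aj).
split=> //.
- move=> B B_sat i x Ai [_ nBx] y Aiy; split => // By.
  exact/nBx/(B_sat i y).
- move=> B B_sat i x Ai [n _ Bx] y Aiy; exists n => //.
  exact: (B_sat n i x).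
Qed.

(** The core is itself admissible in the supremum, and it contains every
    admissible set since such a set contains the atoms it meets. *)
Lemma capacityE F : v F = P (atom_core F).
Proof.
apply/eqP; rewrite eq_le; apply/andP; split; last first.
  apply: ereal_sup_ubound; exists (atom_core F) => //.
  by split; [exact: atom_core_sigma|exact: atom_core_sub].
apply: ge_ereal_sup => _ [B [GB BF] <-].
apply: le_measure; rewrite ?inE//.
move=> x Bx; have [i Ai] := atom_cover x; exists i => //=.
exact: subset_trans (atom_sub_sigma GB Ai Bx) BF.
Qed.

Lemma atom_core_atom i : atom_core (A i) = A i.
Proof.
by apply/seteqP; split; [exact: atom_core_sub|move=> x Ax; exists i].
Qed.

Lemma atom_core_mono F G : F `<=` G -> atom_core F `<=` atom_core G.
Proof.
by move=> FG x [i /= AF Ax]; exists i => //=; exact: subset_trans FG.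
Qed.

(** Finiteness of the atoms makes [atom_core] commute with increasing unions;
    what remains is continuity from below of [P]. *)
Lemma finite_atoms_continuous_from_below :
  (forall i, finite_set (A i)) -> continuous_from_below v.
Proof.
move=> A_fin F_ F_incr.
have F_nd : nondecreasing_seq F_.
  by apply/nondecreasing_seqP => n; apply/subsetPset; exact: F_incr.
rewrite capacityE (_ : atom_core _ = \bigcup_n atom_core (F_ n)); last first.
  apply/seteqP; split => [x [i /= AF Ax]|x [n _]].
    have [n AFn] := finite_sub_bigcup (A_fin i) F_nd AF.
    by exists n => //; exists i.
  by apply: atom_core_mono => y Fy; exists n.
under eq_fun do rewrite capacityE.
apply: nondecreasing_cvg_mu => //.
by move=> m n mn; apply/subsetPset/atom_core_mono/subsetPset/F_nd.
Qed.

Hypothesis A_pos : forall i, (0 < P (A i))%E.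

(** The atom of a point outside [F] avoids the core of [F], which would then
    miss a positive probability. *)
Lemma capacity_full F : v F = v setT -> F = setT.
Proof.
rewrite !capacityE => PF; apply/seteqP; split => // x _.
apply: contrapT => nFx; have [i Ai] := atom_cover x.
have coreT : atom_core setT = setT.
  by apply/seteqP; split => // y _; have [j Aj] := atom_cover y; exists j.
have Ai_out : A i `<=` ~` atom_core F.
  move=> y Aiy [j /= AF Ajy]; apply: nFx; apply: AF.
  by rewrite (atom_inj Ajy Aiy).
have := A_pos i; rewrite ltNge => /negP; apply.
have <- : P (~` atom_core F) = 0%E.
  by rewrite probability_setC// PF coreT probability_setT subee.
by apply: le_measure; rewrite ?inE.
Qed.

(** Exhaust an infinite atom [A i] by finite sets.  They lie in [A i], so [A i]
    is the only atom that they could contain, and they are too small for it. *)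
Lemma continuous_from_below_finite_atoms :
  countable [set: X] -> continuous_from_below v -> forall i, finite_set (A i).
Proof.
move=> /countable_injP[e e_inj] v_cfb i; apply: contrapT => A_inf.
pose F_ n := [set x | A i x /\ (e x < n)%N].
have F_incr n : F_ n `<=` F_ n.+1 by move=> x [Ax ex]; split; rewrite // ltnW.
have F_cup : \bigcup_n F_ n = A i.
  apply/seteqP; split => [x [n _ []]//|x Ax].
  by exists (e x).+1 => //; split.
have F_fin n : finite_set (F_ n).
  apply: (@sub_finite_set _ _ (e @^-1` `I_n)) => [x []//|].
  by apply: finite_preimage => // x y _ _; apply: e_inj; rewrite inE.
have vF0 n : v (F_ n) = 0%E.
  rewrite capacityE (_ : atom_core _ = set0) ?measure0//.
  apply/seteqP; split => // x [j /= AF Ax].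
  have [Aix _] := AF x Ax; have ji := atom_inj Ax Aix; apply: A_inf.
  by apply: sub_finite_set (F_fin n); rewrite -ji.
have := v_cfb F_ F_incr; rewrite F_cup capacityE atom_core_atom.
under eq_fun do rewrite vF0.
move=> /cvg_lim; rewrite lim_cst// => /(_ _) PA.
by have := A_pos i; rewrite -PA ?ltxx.
Qed.

End capacity_of_a_partition.

Theorem proposition4 (R : realType) (d : measure_display) (X : measurableType d)
    (X_countable : countable [set: X])
    (X_discrete : forall F : set X, measurable F)
    (P : probability X R)
    (I : Type) (I_countable : countable [set: I])
    (A : I -> set X) (A_partition : partition [set: I] A [set: X])
    (A_pos : forall i, (0 < P (A i))%E) :
  let v := capacity P <<s range A >> in
  [<-> forall i, finite_set (A i);
       forall (f_ : nat -> X -> R) (f : X -> R),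
         (forall n x, 0 <= f_ n x) -> (forall x, 0 <= f x) ->
         (forall n x, f_ n x <= f_ n.+1 x) ->
         (forall x, f_ n x @[n --> \oo] --> f x) ->
         choquet_integral v (f_ n) @[n --> \oo] --> choquet_integral v f;
       forall (f_ : nat -> X -> R) (f : X -> R),
         (forall n x, 0 <= f_ n x) -> (forall x, 0 <= f x) ->
         (forall n x, f_ n x <= f_ n.+1 x) ->
         cvg_strongly_ae v f_ f ->
         choquet_integral v (f_ n) @[n --> \oo] --> choquet_integral v f;
       continuous_from_below v].
Proof.
move=> v.
have vE : forall F, v F = P (atom_core A F) by exact: capacityE.
have v_ge0 F : (0 <= v F)%E by rewrite vE.
have v_le1 F : (v F <= 1)%E by rewrite vE probability_le1.
have v_mono F G : F `<=` G -> (v F <= v G)%E.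
  by move=> FG; rewrite !vE le_measure ?inE//; exact: atom_core_mono.
tfae.
- move=> A_fin f_ f _ _ f_incr f_cvg; apply: choquet_integral_cvg => //.
  exact: finite_atoms_continuous_from_below.
- move=> cvg_pt f_ f fn_ge0 f_ge0 f_incr f_ae; apply: cvg_pt => // x.
  have full : [set x | setT x /\ f_ n x @[n --> \oo] --> f x] = setT.
    apply: (capacity_full X_discrete I_countable A_partition A_pos).
    exact: f_ae.
  have : [set: X] x by [].
  by rewrite -full => -[].
- move=> cvg_ae F_ F_incr.
  have F_nd : nondecreasing_seq F_.
    by apply/nondecreasing_seqP => n; apply/subsetPset; exact: F_incr.
  have v0 : v set0 = 0%E.
    rewrite vE (_ : atom_core A set0 = set0) ?measure0//.
    by apply/seteqP; split => // x /atom_core_sub.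
  have choquet_indicE F : choquet_integral v (\1_F : X -> R) = v F.
    exact: choquet_integral_indic.
  rewrite -choquet_indicE; under eq_fun do rewrite -choquet_indicE.
  apply: cvg_ae => //.
  + move=> n x; rewrite !indicE ler_nat.
    case: (boolP (x \in F_ n)) => // /set_mem Fx.
    by rewrite mem_set//; exact: F_incr.
  (* The indicators stabilise at every point, so they converge everywhere. *)
  + move=> G; congr v; apply/seteqP; split => [x []//|x Gx]; split => //.
    have [[n _ Fnx]|nFx] := pselect ((\bigcup_n F_ n) x).
      apply: cvg_near_cst; exists n => //= m /= nm.
      rewrite !indicE !mem_set//; first by exists n.
      by have /subsetPset := F_nd _ _ nm; apply.
    apply: cvg_near_cst; exists 0%N => //= m _.
    rewrite !indicE !memNset// => Fmx; apply: nFx; exists m => //.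
- exact: continuous_from_below_finite_atoms.
Qed.
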